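(* Suppose that $\Gamma$ is a torsion-free hyperbolic group that is not free. Then $\Gamma$ does not admit a faithful (i.e. injective) homomorphism into a finite direct product of nonabelian free groups.
   Context: Hyperbolic means Gromov hyperbolic (in particular finitely generated). *)

(* Defs.v *)
From HB Require Import structures.
From mathcomp Require Import all_boot all_order all_algebra.

Set Implicit Arguments.
Unset Strict Implicit.
Unset Printing Implicit Defensive.

Import GRing.Theory Num.Theory.

Local Open Scope group_scope.

Definition torsion_free (G : groupType) : Prop :=
  forall (x : G) (n : nat), (0 < n)%N -> x ^+ n = 1 -> x = 1.

Definition nonabelian (G : groupType) : Prop :=
  ~ (forall x y : G, commute x y).

(** ** Free groups *)

(* [b] need not be assumed injective: this follows (classically) from the
   existence part of the universal property. *)
Definition free_basis (G : groupType) (X : Type) (b : X -> G) : Prop :=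
  forall (H : groupType) (f : X -> H),
    exists phi : {multiplicative G -> H},
      (forall x, phi (b x) = f x) /\
      (forall psi : {multiplicative G -> H},
         (forall x, psi (b x) = f x) -> psi =1 phi).

(* No condition is put on [X]: the trivial group and the infinite cyclic group
   are free, and free groups of infinite rank are included. *)
Definition free_group (G : groupType) : Prop :=
  exists (X : Type) (b : X -> G), free_basis b.

(** ** Hyperbolic groups *)

Section WordMetric.
Variable G : groupType.
Implicit Types (S : seq G) (g : G).

Definition letters S : seq G := S ++ [seq s^-1 | s <- S].

Definition word_product S g (n : nat) : bool :=
  [exists w : n.-tuple (seq_sub (letters S)), \prod_(s <- w) ssval s == g].

Definition generates S : Prop := forall g, exists n, word_product S g n.

Definition word_length S (genS : generates S) g : nat := ex_minn (genS g).

Definition word_dist S (genS : generates S) (x y : G) : nat :=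
  word_length genS (x^-1 * y).

End WordMetric.

Section GromovHyperbolicity.
Local Open Scope ring_scope.
Variables (T : Type) (d : T -> T -> nat).

Definition gromov_product (w x y : T) : rat :=
  ((d x w)%:R + (d y w)%:R - (d x y)%:R) / 2%:R.

(* As [d] is integer-valued, it makes no difference whether the constant
   [delta] is rational or real. *)
Definition gromov_hyperbolic : Prop :=
  exists delta : rat, 0 <= delta /\
    forall w x y z : T,
      Num.min (gromov_product w x y) (gromov_product w y z) - delta
        <= gromov_product w x z.

End GromovHyperbolicity.

Definition hyperbolic_group (G : groupType) : Prop :=
  exists (S : seq G) (genS : generates S), gromov_hyperbolic (word_dist genS).

(** ** Finite direct products *)

(* The library only provides the group structure on such products for families
   of finite groups. *)
Definition finite_group_prod (n : nat) (F : 'I_n -> groupType) : Type :=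
  {dffun forall i : 'I_n, F i}.

Section DirectProduct.
Variables (n : nat) (F : 'I_n -> groupType).

HB.instance Definition _ := Choice.on (finite_group_prod F).

Let mulp (u v : finite_group_prod F) : finite_group_prod F :=
  [ffun i => u i * v i].
Let onep : finite_group_prod F := [ffun i => 1].
Let invp (u : finite_group_prod F) : finite_group_prod F :=
  [ffun i => (u i)^-1].

Fact finite_group_prod_mulA : associative mulp.
Proof. by move=> u v w; apply/ffunP=> i; rewrite !ffunE mulgA. Qed.

Fact finite_group_prod_mul1 : left_id onep mulp.
Proof. by move=> u; apply/ffunP=> i; rewrite !ffunE mul1g. Qed.

Fact finite_group_prod_mulr1 : right_id onep mulp.
Proof. by move=> u; apply/ffunP=> i; rewrite !ffunE mulg1. Qed.

Fact finite_group_prod_mulV : left_inverse onep invp mulp.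
Proof. by move=> u; apply/ffunP=> i; rewrite !ffunE mulVg. Qed.

Fact finite_group_prod_mulrV : right_inverse onep invp mulp.
Proof. by move=> u; apply/ffunP=> i; rewrite !ffunE mulgV. Qed.

HB.instance Definition _ := isGroup.Build (finite_group_prod F)
  finite_group_prod_mulA finite_group_prod_mul1 finite_group_prod_mulr1
  finite_group_prod_mulV finite_group_prod_mulrV.

End DirectProduct.

(* Main.v *)
Require Import Defs.
From HB Require Import structures.
From mathcomp Require Import all_boot all_order all_algebra.
From mathcomp Require Import boolp classical_sets zify lra.

(** Let [Gamma] be hyperbolic and embedded in a product of free groups [F i].
    Then [Gamma] is free, for the following reason.

    Choose a smallest set [I] of indices such that the coordinates in [I]
    already separate the points of [Gamma].  By minimality every [i] in [I] has
    a witness: a nontrivial element of [Gamma] all of whose coordinates in [I]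
    other than the [i]-th vanish.  Witnesses [x], [y] for two different indices
    commute, since in each coordinate of [I] at least one of them is trivial.
    They would generate a copy of Z^2, which a hyperbolic group cannot contain
    ([no_independent_commuting_pair]).  So [I] has at most one element: either
    [Gamma] is trivial, or one coordinate embeds it in a free group, and
    [nielsen_schreier] applies.

    The absence of Z^2 is much easier to prove here than for hyperbolic groups
    in general, because the two coordinates bound word length from below.  In a
    free group [n <= |u^n|] for every [u != 1] ([free_length]), and
    homomorphisms are Lipschitz, so in the word length of [Gamma] the elements
    [x^n y^m] and [x^n y^-m] have length at least a constant times [n].  On the
    other hand the four-point condition at the corners [1, a, a b, b] of a
    quadrilateral with [a b = b a] reads
      [|a b| + |a b^-1| <= 2 max(|a|, |b|) + D].
    Apply it to powers [a] of [x] and [b] of [y] whose lengths are at most [r],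
    and then to the pair [a b], [a b^-1], whose product and quotient are [a^2]
    and [b^2]:
      [|a^2| + |b^2| <= 2 max(|a b|, |a b^-1|) + D
                     <= 4 r + 3 D - 2 min(|a b|, |a b^-1|)].
    The last minimum is at least a fixed fraction of [r].  If [a] and [b] are
    powers of elements for which [|x^n| / n] and [|y^n| / n] are almost
    minimal ([almost_minimal_slope]), then [|a^2|] and [|b^2|] are almost [2 r],
    and letting [r] grow gives a contradiction.

    Free groups are known only by their universal property.  It is used
    throughout in the following form: a family of bijections of a set, indexed
    by the basis, extends to an action of the free group
    ([free_action_exists]).  Acting on reduced words gives normal forms, hence
    the length; acting on [K * F], for an arbitrary group [K], gives the
    universal property of a subgroup. *)

Set Implicit Arguments.
Unset Strict Implicit.
Unset Printing Implicit Defensive.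

Local Open Scope group_scope.

(** * Actions of free groups *)

Section MultiplicativeMaps.
Variables (G H : groupType) (phi : {multiplicative G -> H}).

Lemma multiplicative1 : phi 1 = 1.
Proof. by apply: (mulgI (phi 1)); rewrite -gmulfM !mulg1. Qed.

Lemma multiplicativeV g : phi g^-1 = (phi g)^-1.
Proof. by apply: (mulgI (phi g)); rewrite -gmulfM !mulgV multiplicative1. Qed.

Lemma multiplicativeX g n : phi (g ^+ n) = phi g ^+ n.
Proof.
by elim: n => [|n IHn]; rewrite ?multiplicative1 // !expgS gmulfM IHn.
Qed.

End MultiplicativeMaps.

(** A bijection is stored with its inverse, which makes inversion explicit. *)
Definition bijection (T : Type) : Type :=
  {p : (T -> T) * (T -> T) | cancel p.1 p.2 /\ cancel p.2 p.1}.

Section Bijections.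
Variable T : Type.
Implicit Types p q : bijection T.

HB.instance Definition _ := gen_eqMixin (bijection T).
HB.instance Definition _ := gen_choiceMixin (bijection T).

Lemma bijection_ext p q : (sval p).1 =1 (sval q).1 -> p = q.
Proof.
case: p q => [[f f'] /= [fK f'K]] [[g g'] /= [gK g'K]] /= efg.
apply: eq_exist => /=; congr (_, _); apply/funext => // z.
by rewrite -{1}[z]g'K -efg fK.
Qed.

Let mulb p q : bijection T.
Proof.
exists ((sval p).1 \o (sval q).1, (sval q).2 \o (sval p).2).
by case: p q => [p [pK p'K]] [q [qK q'K]] /=; split; apply: can_comp.
Defined.

Let oneb : bijection T := exist _ (id, id) (conj (frefl _) (frefl _)).

Let invb p : bijection T :=
  exist _ ((sval p).2, (sval p).1) (conj (proj2 (svalP p)) (proj1 (svalP p))).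

Fact bijection_mulA : associative mulb.
Proof. by move=> p q r; apply: bijection_ext. Qed.

Fact bijection_mul1 : left_id oneb mulb.
Proof. by move=> p; apply: bijection_ext. Qed.

Fact bijection_mulr1 : right_id oneb mulb.
Proof. by move=> p; apply: bijection_ext. Qed.

Fact bijection_mulV : left_inverse oneb invb mulb.
Proof.
by move=> p; apply: bijection_ext => z; case: p => p [pK ?] /=; exact: pK.
Qed.

Fact bijection_mulrV : right_inverse oneb invb mulb.
Proof.
by move=> p; apply: bijection_ext => z; case: p => p [? pK] /=; exact: pK.
Qed.

HB.instance Definition _ := isGroup.Build (bijection T)
  bijection_mulA bijection_mul1 bijection_mulr1 bijection_mulV bijection_mulrV.

End Bijections.

(** Actions by plain functions, on types without decidable equality; the first
    field is a coercion, so that [a g z] is the action of [g] on [z]. *)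
Record action_of (G : groupType) (T : Type) := GroupAction {
  act :> G -> T -> T;
  act1 : act 1 =1 id;
  actM : forall g h z, act (g * h) z = act g (act h z) }.

Section Actions.
Variables (G : groupType) (T : Type) (a : action_of G T).

Lemma actK g : cancel (a g) (a g^-1).
Proof. by move=> z; rewrite -actM mulVg act1. Qed.

Lemma actKV g : cancel (a g^-1) (a g).
Proof. by move=> z; rewrite -actM mulgV act1. Qed.

Definition bijection_of_act g : bijection T :=
  exist _ (a g, a g^-1) (conj (actK g) (actKV g)).

Fact bijection_of_act_morph : {morph bijection_of_act : g h / g * h}.
Proof. by move=> g h; apply: bijection_ext => z /=; rewrite actM. Qed.

HB.instance Definition _ :=
  isMultiplicative.Build G (bijection T) bijection_of_act
    bijection_of_act_morph.

End Actions.

Definition left_mul_act (G : groupType) : action_of G G :=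
  @GroupAction G G *%g (@mul1g G) (fun g h z => esym (mulgA g h z)).

Section FreeBasis.
Variables (F : groupType) (X : Type) (b : X -> F).
Hypothesis bF : free_basis b.

(** The universal property for the group of bijections of [T]. *)
Lemma free_action_exists (T : Type) (s s' : X -> T -> T) :
    (forall x, cancel (s x) (s' x)) -> (forall x, cancel (s' x) (s x)) ->
  exists a : action_of F T, forall x, a (b x) =1 s x.
Proof.
move=> sK s'K.
pose f x : bijection T := exist _ (s x, s' x) (conj (sK x) (s'K x)).
have [phi [phib _]] := bF f.
have a1 : (sval (phi 1)).1 =1 id by rewrite multiplicative1.
have aM g h z :
  (sval (phi (g * h))).1 z = (sval (phi g)).1 ((sval (phi h)).1 z).
  by rewrite gmulfM.
exists (@GroupAction _ _ (fun g => (sval (phi g)).1) a1 aM) => x z.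
by rewrite /= phib.
Qed.

Lemma free_action_unique (T : Type) (a a' : action_of F T) :
  (forall x, a (b x) =1 a' (b x)) -> forall g, a g =1 a' g.
Proof.
move=> eaa' g z.
have [phi [_ phiU]] := bF (bijection_of_act a \o b).
have /(_ g) e1 := phiU (bijection_of_act a) (fun=> erefl).
have /phiU/(_ g) e2 x : bijection_of_act a' (b x) = (bijection_of_act a \o b) x.
  by apply: bijection_ext => y /=; rewrite eaa'.
by have /(congr1 (fun p => (sval p).1 z)) := etrans e1 (esym e2).
Qed.

(** The basis generates [F].  If [P] is invariant under the generators, then on
    two copies of [F] the translation action commutes, for generators, with the
    exchange of the two copies of each point of [P].  So translation and its
    conjugate by this exchange agree, by uniqueness; comparing them at the point
    over [1] shows that every [g] satisfies [P]. *)
Lemma free_basis_ind (P : F -> Prop) :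
  P 1 -> (forall x g, P g <-> P (b x * g)) -> forall g, P g.
Proof.
move=> P1 Pb g.
pose k u := `[< P u >].
pose a1 g (z : F * bool) := (g * z.1, z.2).
pose a2 g (z : F * bool) := (g * z.1, k (g * z.1) (+) k z.1 (+) z.2).
have a1A : a1 1 =1 id by case=> u c; rewrite /a1 mul1g.
have a1M g1 g2 z : a1 (g1 * g2) z = a1 g1 (a1 g2 z) by rewrite /a1 mulgA.
have a2A : a2 1 =1 id by case=> u c; rewrite /a2 mul1g addbb.
have a2M g1 g2 z : a2 (g1 * g2) z = a2 g1 (a2 g2 z).
  rewrite /a2 /= -mulgA; congr (_, _).
  by case: (k (g1 * _)) (k (g2 * _)) (k z.1) z.2 => [] [] [] [].
have a12 x : a1 (b x) =1 a2 (b x).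
  case=> u c; rewrite /a1 /a2 /=; congr (_, _).
  suff -> : k (b x * u) = k u by rewrite addbb.
  by apply: asbool_equiv_eq; apply: iff_sym.
have := @free_action_unique _ (@GroupAction _ _ a1 a1A a1M)
  (@GroupAction _ _ a2 a2A a2M) a12 g (1, false).
case; rewrite mulg1 addbF => e; apply/asboolP.
by move: e; rewrite -/(k g) /(k 1) (asboolT P1); case: (k g).
Qed.

(** Several facts on an action of [F] are instances of this one: a map [r] that
    respects the generators respects every element of [F]. *)
Lemma free_action_equivariant (T T' : Type)
    (a : action_of F T) (a' : action_of F T') (r : T -> T') :
    (forall x z, r (a (b x) z) = a' (b x) (r z)) ->
  forall g z, r (a g z) = a' g (r z).
Proof.
move=> rb; elim/free_basis_ind => [z|x g]; first by rewrite !act1.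
split=> rg z; first by rewrite !actM rb rg.
by rewrite -[LHS](actK a' (b x)) -rb -actM rg actM actK.
Qed.

End FreeBasis.

(** * Word length in a free group *)

Section ReducedWords.
Variable X : eqType.
Implicit Types (l : X * bool) (w : seq (X * bool)).

Definition inv_letter l : X * bool := (l.1, ~~ l.2).

Definition no_cancel l l' : bool := l' != inv_letter l.

Definition reduced w : bool := sorted no_cancel w.

(** Left multiplication by a letter, on reduced words.  Words that are not
    reduced are left unchanged, which makes [push_letter l] a bijection of the
    type of all words. *)
Definition push_letter l w : seq (X * bool) :=
  if ~~ reduced w then w
  else if w is l' :: w' then if l' == inv_letter l then w' else l :: w
  else [:: l].

Lemma inv_letterK : involutive inv_letter.
Proof. by case=> x c; rewrite /inv_letter /= negbK. Qed.

Lemma inv_letter_neq l : l != inv_letter l.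
Proof. by case: l => x c; rewrite /inv_letter xpair_eqE eqxx; case: c. Qed.

Lemma reduced_push l w : reduced w -> reduced (push_letter l w).
Proof.
move=> rw; rewrite /push_letter rw /=.
case: w rw => [//|l' w] rw; case: eqP => [_|/eqP nll'].
  exact: path_sorted rw.
by rewrite /reduced /= in rw *; rewrite /no_cancel nll'.
Qed.

Lemma push_letterK l : cancel (push_letter l) (push_letter (inv_letter l)).
Proof.
move=> w; have [rw|nrw] := boolP (reduced w); last first.
  by rewrite /push_letter nrw nrw.
rewrite {1}/push_letter (reduced_push _ rw) /= /push_letter rw /=.
case: w rw => [|l' w] rw; first by rewrite inv_letterK eqxx.
case: eqP => [el|_]; last by rewrite inv_letterK eqxx.
case: w rw => [|l'' w] rw; first by rewrite el.
by move: rw; rewrite /reduced /= {1}/no_cancel el => /andP[/negPf -> _].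
Qed.

Lemma push_letterVK l : cancel (push_letter (inv_letter l)) (push_letter l).
Proof. by rewrite -{2}[l]inv_letterK; exact: push_letterK. Qed.

Lemma size_push_letter l w : (size (push_letter l w) <= (size w).+1)%N.
Proof.
rewrite /push_letter; case: ifP => // _.
case: w => // l' w; case: ifP => //= _; lia.
Qed.

Lemma push_letter_cons l w : reduced (l :: w) -> push_letter l w = l :: w.
Proof.
move=> rlw; have rw : reduced w by exact: path_sorted rlw.
rewrite /push_letter rw /=; case: w rlw {rw} => // l' w.
by rewrite /reduced /= {1}/no_cancel => /andP[/negPf -> _].
Qed.

Lemma reduced_power w n : cycle no_cancel w -> reduced (flatten (nseq n w)).
Proof.
case: w => [_|l w]; first by elim: n.
rewrite /= rcons_path => /andP[pw lw].
case: n => // n /=; rewrite /reduced /= cat_path pw /=.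
by elim: n => //= n IHn; rewrite lw cat_path pw.
Qed.

End ReducedWords.

Section FreeLength.
Variables (F : groupType) (X : eqType) (b : X -> F).
Hypothesis bF : free_basis b.
Implicit Types (l : X * bool) (w : seq (X * bool)).

Definition eval_letter l : F := if l.2 then b l.1 else (b l.1)^-1.

Definition eval_word w : F := foldr (fun l g => eval_letter l * g) 1 w.

Lemma eval_inv_letter l : eval_letter (inv_letter l) = (eval_letter l)^-1.
Proof. by case: l => x [] //=; rewrite /eval_letter /= invgK. Qed.

Lemma eval_word_cat w w' : eval_word (w ++ w') = eval_word w * eval_word w'.
Proof. by elim: w => [|l w IHw] /=; rewrite ?mul1g // IHw mulgA. Qed.

Lemma eval_word_power w n :
  eval_word (flatten (nseq n w)) = eval_word w ^+ n.
Proof. by elim: n => //= n IHn; rewrite eval_word_cat IHn expgS. Qed.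

Lemma eval_push_letter l w :
  reduced w -> eval_word (push_letter l w) = eval_letter l * eval_word w.
Proof.
move=> rw; rewrite /push_letter rw /=; case: w rw => // l' w _.
by case: eqP => [->|//] /=; rewrite eval_inv_letter mulVKg.
Qed.

(** Reduced words are normal forms: when [F] acts on words by [push_letter],
    the normal form of [g] is the image under [g] of the empty word. *)
Lemma reduced_form_exists :
  exists nf : F -> seq (X * bool),
    [/\ forall w, reduced w -> nf (eval_word w) = w,
        forall g, reduced (nf g) /\ eval_word (nf g) = g
      & forall g h, (size (nf (g * h)%g) <= size (nf g) + size (nf h))%N].
Proof.
have [a ab] := free_action_exists bF
  (fun x => push_letterK (x, true)) (fun x => push_letterVK (x, true)).
have al l : a (eval_letter l) =1 push_letter l.
  case: l => x [] w //=; rewrite /eval_letter /=; first exact: ab.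
  by rewrite -{1}[w](push_letterVK (x, true)) -ab actK.
have aw w v : (size (a (eval_word w) v) <= size w + size v)%N.
  elim: w => [|l w IHw] /=; first by rewrite act1.
  by rewrite actM al (leq_trans (size_push_letter _ _)).
have nfg g : reduced (a g [::]) /\ eval_word (a g [::]) = g.
  elim/(free_basis_ind bF): g => [|x g]; first by rewrite act1.
  split=> -[rg eg].
    rewrite actM ab reduced_push // eval_push_letter // eg.
    by rewrite -[b x]/(eval_letter (x, true)).
  have -> : a g [::] = push_letter (x, false) (a (b x * g) [::]).
    by rewrite -(al (x, false)) -actM mulKg.
  by rewrite reduced_push // eval_push_letter // eg /eval_letter mulKg.
exists (fun g => a g [::]); split=> // [w|g h].
  elim: w => [|l w IHw] rw /=; first by rewrite act1.
  by rewrite actM al IHw ?push_letter_cons //; exact: path_sorted rw.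
by rewrite actM -{1}[g](proj2 (nfg g)) aw.
Qed.

(** A nontrivial [u] has a conjugate [u ^ v] with a shortest normal form [w].
    This [w] is cyclically reduced, as otherwise conjugating by its first letter
    would shorten it; so the powers of [w] are reduced, and [(u ^ v) ^+ m] has
    length at least [m].  Conjugation changes lengths by a bounded amount only,
    and the bound disappears on applying this to high powers of [u ^+ n]. *)
Lemma free_basis_length :
  exists len : F -> nat,
    [/\ len 1 = 0%N, forall g h, (len (g * h)%g <= len g + len h)%N
      & forall u n, u != 1 -> (n <= len (u ^+ n))%N].
Proof.
have [nf [nfK evK nfM]] := reduced_form_exists.
pose len g := size (nf g); exists len.
have len1 : len 1 = 0%N by rewrite /len (nfK [::]).
split=> // u n u1.
have lenX g m : (len (g ^+ m) <= m * len g)%N.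
  elim: m => [|m IHm]; first by rewrite len1.
  by rewrite expgS (leq_trans (nfM _ _)) // mulSn leq_add2l.
have [v vmin] : exists v, forall v', (len (u ^ v)%g <= len (u ^ v')%g)%N.
  have ex : exists m, `[< exists v, len (u ^ v) = m >].
    by exists (len (u ^ 1)); apply/asboolP; exists 1.
  case: (ex_minnP ex) => m /asboolP[v <-] vmin; exists v => v'.
  by apply: vmin; apply/asboolP; exists v'.
have [w [rw ew sw]] :
    exists w, [/\ reduced w, eval_word w = u ^ v & len (u ^ v) = size w].
  by exists (nf (u ^ v)); have [] := evK (u ^ v).
have cw : cycle (@no_cancel X) w.
  case: w rw ew sw => // l w rw ew sw; rewrite /= rcons_path; apply/andP.
  split=> //; case/lastP: w rw ew sw => [|w l'] rw ew sw /=.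
    exact: inv_letter_neq.
  rewrite last_rcons; apply/eqP => el.
  have := vmin (v * eval_letter l); rewrite sw conjgM -ew.
  have -> : eval_word (l :: rcons w l') ^ eval_letter l = eval_word w.
    rewrite conjgE /= -cats1 eval_word_cat /= mulg1 -!mulgA mulKg.
    by rewrite el eval_inv_letter mulgV mulg1.
  rewrite /len nfK /= ?size_rcons; first lia.
  move: rw; rewrite /reduced /= rcons_path => /andP[rw _].
  exact: path_sorted rw.
have w0 : (0 < size w)%N.
  case: w ew {rw sw cw} => // /eqP; rewrite eq_sym conjg_eq1 => /eqP.
  by move/eqP: u1.
have conj_bound k : (n * k <= k * len (u ^+ n) + len v + len v^-1)%N.
  have : (n * k <= len ((u ^ v) ^+ (n * k))%g)%N.
    rewrite -ew -eval_word_power /len nfK ?reduced_power //.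
    by rewrite size_flatten /shape map_nseq sumn_nseq leq_pmull.
  rewrite -conjXg conjgE expgnA => /leq_trans; apply.
  apply: leq_trans (nfM _ _) _; rewrite -/(len _) addnC leq_add2r.
  by apply: leq_trans (nfM _ _) _; rewrite leq_add2r lenX.
have := conj_bound (len v + len v^-1).+1.
rewrite leqNgt => le1; rewrite leqNgt; apply: contra le1 => lt.
nia.
Qed.

End FreeLength.

Lemma free_length (F : groupType) : free_group F ->
  exists len : F -> nat,
    [/\ len 1 = 0%N, forall g h, (len (g * h)%g <= len g + len h)%N
      & forall u n, u != 1 -> (n <= len (u ^+ n))%N].
Proof.
by move=> [X [b bF]]; exact: (@free_basis_length F {classic X} b bF).
Qed.

(** * Subgroups of free groups *)

Section SchreierTransversal.
Variables (F : groupType) (X : Type) (b : X -> F).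
Hypothesis bF : free_basis b.
Variable H : F -> Prop.
Hypotheses (H1 : H 1) (HM : forall g h, H g -> H h -> H (g * h)).
Hypothesis (HV : forall g, H g -> H g^-1).

Definition letter (y : F) : Prop := exists x, y = b x \/ y = (b x)^-1.

(** The coset [u H] is the end of a walk of [n] steps from [H] in the Schreier
    graph; that is, it contains a product of [n] letters. *)
Fixpoint coset_walk (n : nat) (u : F) : Prop :=
  if n is n'.+1 then exists2 y, letter y & coset_walk n' (y^-1 * u) else H u.

Lemma subgroup_mulr u h : H h -> H (u * h) <-> H u.
Proof.
move=> hH; split=> [uhH|uH]; last exact: HM.
by rewrite -[u](mulgK h); apply: HM uhH (HV hH).
Qed.

Lemma coset_walk_mulr n u h : H h -> coset_walk n (u * h) <-> coset_walk n u.
Proof.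
move=> hH; elim: n u => [|n IHn] u /=; first exact: subgroup_mulr.
by split=> -[y yl]; [rewrite mulgA|] => /IHn; exists y; rewrite // mulgA.
Qed.

Lemma coset_walk_exists u : exists n, `[< coset_walk n u >].
Proof.
suff [n un] : exists n, coset_walk n u by exists n; apply/asboolP.
elim/(free_basis_ind bF): u => [|x u]; first by exists 0.
split=> -[n un]; exists n.+1.
  by exists (b x); [exists x; left | rewrite mulKg].
by exists (b x)^-1; [exists x; right | rewrite invgK].
Qed.

Definition coset_length u : nat := ex_minn (coset_walk_exists u).

Lemma coset_lengthP u n : coset_walk n u -> (coset_length u <= n)%N.
Proof.
move=> un; rewrite /coset_length; case: ex_minnP => m _; apply.
exact/asboolP.
Qed.

Lemma coset_walk_length u : coset_walk (coset_length u) u.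
Proof. by rewrite /coset_length; case: ex_minnP => m /asboolP. Qed.

Lemma coset_length_mulr u h : H h -> coset_length (u * h) = coset_length u.
Proof.
move=> hH; apply/eqP; rewrite eqn_leq; apply/andP; split; apply: coset_lengthP.
  by apply/coset_walk_mulr => //; exact: coset_walk_length.
by apply/(coset_walk_mulr _ _ hH); exact: coset_walk_length.
Qed.

Definition shortening_letter u (y : F) : Prop :=
  letter y /\ (coset_length (y^-1 * u) < coset_length u)%N.

(** The first step of a geodesic from [u H] to [H].  The choice depends only on
    the set of possible steps, hence only on the coset. *)
Definition first_letter u : F := xget 1 (shortening_letter u).

Lemma first_letterP u : ~ H u ->
  letter (first_letter u) /\
  (coset_length ((first_letter u)^-1 * u) < coset_length u)%N.
Proof.
move=> nHu; have := @coset_walk_length u.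
case e : (coset_length u) => [|n] //= -[y yl yn].
have yP : shortening_letter u y.
  by split=> //; rewrite e ltnS; exact: coset_lengthP.
by rewrite -e; exact: (xgetPex 1 (ex_intro _ y yP)).
Qed.

Lemma first_letter_mulr u h : H h -> first_letter (u * h) = first_letter u.
Proof.
move=> hH; congr (xget 1 _); apply/funext => y; apply/propext.
by rewrite /shortening_letter mulgA !(coset_length_mulr _ hH).
Qed.

(** The argument [n] only bounds the recursion: any [n] not smaller than the
    distance from [u H] to [H] gives the same result. *)
Fixpoint coset_rep_rec (n : nat) (u : F) : F :=
  if pselect (H u) is left _ then 1 else
  if n is n'.+1 then
    first_letter u * coset_rep_rec n' ((first_letter u)^-1 * u)
  else 1.

Lemma coset_rep_rec_enough n m u :
  (coset_length u <= n)%N -> (coset_length u <= m)%N ->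
  coset_rep_rec n u = coset_rep_rec m u.
Proof.
elim: n m u => [|n IHn] m u.
  rewrite leqn0 => /eqP u0 _; have := coset_walk_length u; rewrite u0 /= => Hu.
  by case: m => /=; case: pselect.
move=> un um; have [Hu|nHu] := pselect (H u).
  by case: m um => /=; case: pselect.
have [_ lt] := first_letterP nHu; case: m um => [|m] um; first lia.
by rewrite /=; case: pselect => // _; congr (_ * _); apply: IHn; lia.
Qed.

(** Following chosen geodesics to [H] yields representatives [t u] of the cosets
    [u H] such that, if [y] is the first letter of [t u] and [t u = y * v], then
    [v] is again a representative.  The last clause is induction along these
    geodesics. *)
Lemma schreier_transversal : exists t : F -> F,
  [/\ t 1 = 1,
      forall u, H ((t u)^-1 * u),
      forall u h, H h -> t (u * h) = t u
    & forall P : F -> Prop,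
        (forall u, t u = 1 -> P u) ->
        (forall u y, letter y -> t u = y * t (y^-1 * u) ->
           P (y^-1 * u) -> P u) ->
        forall u, P u].
Proof.
pose t u := coset_rep_rec (coset_length u) u.
have t1 u : H u -> t u = 1.
  by rewrite /t; case: (coset_length u) => /=; case: pselect.
have tE u : ~ H u -> t u = first_letter u * t ((first_letter u)^-1 * u).
  move=> nHu; have [_ lt] := first_letterP nHu.
  rewrite {1}/t; case e : (coset_length u) => [|n]; first lia.
  rewrite /=; case: pselect => // _; congr (_ * _).
  by apply: coset_rep_rec_enough => //; lia.
have tind (P : F -> Prop) : (forall u, H u -> P u) ->
    (forall u, ~ H u -> P ((first_letter u)^-1 * u) -> P u) ->
    forall u, P u.
  move=> PH Pl u; have [n] := ubnP (coset_length u); elim: n u => // n IHn u un.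
  have [Hu|nHu] := pselect (H u); first exact: PH.
  by apply: Pl => //; apply: IHn; have [_] := first_letterP nHu; lia.
exists t; split.
- exact: t1.
- apply: tind => u Hu; first by rewrite t1 // invg1 mul1g.
  by move=> IHu; rewrite tE // invgM -mulgA.
- move=> u h hH; elim/tind: u => u Hu.
    by rewrite !t1 //; exact: HM.
  move=> IHu; rewrite tE; last by move/(subgroup_mulr _ hH).
  by rewrite (tE u) // first_letter_mulr // mulgA IHu.
- move=> P P1 Pl; apply: tind => u Hu; first exact/P1/t1.
  by apply: Pl; [case: (first_letterP Hu) | exact: tE].
Qed.

End SchreierTransversal.

(** The subgroup is given as the image of an injective map [psi], and its basis
    as a family of elements of the source [G].  The proof needs no normal forms:
    for a function [f] from the Schreier generators to a group [K], the free
    group acts on [K * F] by translation on [F], combined with the values of [f]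
    on [K], and the extension of [f] is read off from the orbit of [(1, 1)]. *)
Section NielsenSchreier.
Variables (F : groupType) (X : Type) (b : X -> F).
Hypothesis bF : free_basis b.
Variables (G : groupType) (psi : {multiplicative G -> F}).
Hypothesis psi_inj : injective psi.

Let H (u : F) : Prop := exists g, psi g = u.

Let HM u v : H u -> H v -> H (u * v).
Proof. by move=> [g <-] [h <-]; exists (g * h); rewrite gmulfM. Qed.

Let HV u : H u -> H u^-1.
Proof. by move=> [g <-]; exists g^-1; rewrite multiplicativeV. Qed.

Variable t : F -> F.
Hypotheses (t1 : t 1 = 1) (tH : forall u, H ((t u)^-1 * u)).
Hypothesis t_mulr : forall u h, H h -> t (u * h) = t u.
Hypothesis t_ind : forall P : F -> Prop,
  (forall u, t u = 1 -> P u) ->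
  (forall u y, letter b y -> t u = y * t (y^-1 * u) -> P (y^-1 * u) -> P u) ->
  forall u, P u.

Lemma t_psi g : t (psi g) = 1.
Proof. by rewrite -[psi g]mul1g t_mulr //; exists g. Qed.

Lemma t_coset u : exists2 h, H h & t u = u * h.
Proof.
exists (u^-1 * t u); last by rewrite mulVKg.
by rewrite -[u^-1 * _]invgK invgM invgK; apply: HV.
Qed.

Lemma t_idem u : t (t u) = t u.
Proof. by have [h hH e] := t_coset u; rewrite {1}e t_mulr. Qed.

Lemma schreier_subproof x u : H ((t (b x * u))^-1 * (b x * t u)).
Proof.
have [h hH ->] := t_coset u; rewrite !mulgA.
by apply: HM => //; rewrite -mulgA.
Qed.

Definition schreier_gen x u : G := proj1_sig (cid (schreier_subproof x u)).

Lemma psi_schreier_gen x u :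
  psi (schreier_gen x u) = (t (b x * u))^-1 * (b x * t u).
Proof. exact: proj2_sig (cid (schreier_subproof x u)). Qed.

Lemma schreier_gen_mulr x u h :
  H h -> schreier_gen x (u * h) = schreier_gen x u.
Proof.
move=> hH; apply: psi_inj; rewrite !psi_schreier_gen (mulgA _ u).
by rewrite (t_mulr (b x * u)) // (t_mulr u).
Qed.

Lemma schreier_gen_t x u : schreier_gen x (t u) = schreier_gen x u.
Proof. by have [h hH ->] := t_coset u; rewrite schreier_gen_mulr. Qed.

(** Trivial generators must be left out, and [x] is paired with coset
    representatives only so that no generator is listed twice for one coset. *)
Definition schreier_index : Type :=
  {p : X * F | t p.2 = p.2 /\ schreier_gen p.1 p.2 <> 1}.

Definition schreier_basis (p : schreier_index) : G :=
  schreier_gen (sval p).1 (sval p).2.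

Section Existence.
Variables (K : groupType) (f : schreier_index -> K).

(** The values of [f], as a function on all pairs of a basis element and an
    element of [F], with value [1] at trivial Schreier generators. *)
Definition ext_gen x u : K :=
  if pselect (t (t u) = t u /\ schreier_gen x (t u) <> 1) is left e
  then f (exist _ (x, t u) e) else 1.

Lemma ext_gen_trivial x u : schreier_gen x u = 1 -> ext_gen x u = 1.
Proof.
rewrite -schreier_gen_t /ext_gen => g1.
by case: pselect => // -[? n1]; case: (n1 g1).
Qed.

Lemma ext_gen_mulr x u h : H h -> ext_gen x (u * h) = ext_gen x u.
Proof. by move=> hH; rewrite /ext_gen t_mulr. Qed.

Lemma ext_gen_basis p : ext_gen (sval p).1 (sval p).2 = f p.
Proof.
case: p => -[x u] /= [tu nu]; rewrite /ext_gen.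
case: pselect => [e|[]]; last by rewrite !tu.
by congr f; apply: eq_exist; rewrite tu.
Qed.

(** The action on [K * F] commutes with right multiplication by [K] and by the
    subgroup; this makes multiplicative the map [phi] that sends [g] to the
    first component of the image of [(1, 1)] under [psi g].  Along a
    representative [t u] only trivial Schreier generators are met, so [t u]
    sends [(1, 1)] to [(1, t u)]; hence
    [t (b x * u) * psi (schreier_gen x u) = b x * t u] sends [(1, 1)] both to a
    point over [phi (schreier_gen x u)] and to one over [ext_gen x u]. *)
Lemma schreier_extension_exists :
  exists phi : {multiplicative G -> K}, forall p, phi (schreier_basis p) = f p.
Proof.
pose s x (z : K * F) := (ext_gen x z.2 * z.1, b x * z.2).
pose s' x (z : K * F) :=
  ((ext_gen x ((b x)^-1 * z.2))^-1 * z.1, (b x)^-1 * z.2).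
have sK x : cancel (s x) (s' x) by case=> a u; rewrite /s /s' /= !mulKg.
have s'K x : cancel (s' x) (s x) by case=> a u; rewrite /s /s' /= !mulVKg.
have [a ab] := free_action_exists bF sK s'K.
have a2 g z : (a g z).2 = g * z.2.
  apply: (free_action_equivariant bF (a' := left_mul_act F) (r := snd)).
  by move=> x {}z; rewrite ab.
have a_mulr g z c h : H h ->
    a g (z.1 * c, z.2 * h) = ((a g z).1 * c, (a g z).2 * h).
  move=> hH; symmetry.
  apply: (free_action_equivariant bF (a' := a)
           (r := fun z => (z.1 * c, z.2 * h))).
  by move=> x {}z; rewrite !ab /s /= ext_gen_mulr // !mulgA.
pose phi g := (a (psi g) (1, 1)).1.
have phiE u g : a (u * psi g) (1, 1) = ((a u (1, 1)).1 * phi g, u * psi g).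
  have -> : a (u * psi g) (1, 1) = a u (1 * phi g, 1 * psi g).
    rewrite actM; congr (a u _).
    by rewrite [LHS]surjective_pairing a2 !mul1g mulg1.
  by rewrite (a_mulr u (1, 1)) /=; [rewrite a2 mulg1 | exists g].
have phiM : {morph phi : g h / g * h}.
  by move=> g h; rewrite {1}/phi gmulfM phiE.
have at1 u : a (t u) (1, 1) = (1, t u).
  elim/t_ind: u => [u ->|u y [x xy] tu IHu]; first by rewrite act1.
  case: xy => ey; rewrite {y}ey in tu IHu *.
    rewrite tu actM IHu ab /s /= ext_gen_trivial ?mul1g //.
    apply: psi_inj; rewrite psi_schreier_gen t_idem -tu t_idem mulVg.
    by rewrite multiplicative1.
  rewrite invgK in tu IHu.
  have e : b x * t u = t (b x * u) by rewrite tu mulVKg.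
  rewrite {1}tu actM IHu -[RHS](actK a (b x)) ab /s /=.
  rewrite ext_gen_trivial ?mul1g ?e //.
  apply: psi_inj; rewrite psi_schreier_gen t_idem e t_idem mulVg.
  by rewrite multiplicative1.
pose phi' : {multiplicative G -> K} :=
  HB.pack phi (isMultiplicative.Build G K phi phiM).
exists phi' => p; rewrite -ext_gen_basis /= /schreier_basis.
case: p => -[x u] /= [tu _]; set v := schreier_gen x u.
have := phiE (t (b x * u)) v; rewrite at1 mul1g psi_schreier_gen tu mulVKg.
by rewrite actM -{1}tu at1 ab /s /= mulg1 tu => -[->].
Qed.

End Existence.

(** The generators generate: if [psi g = (t u)^-1 * u], then passing from [u] to
    [b x * u] multiplies [g] by a Schreier generator, and for [u = psi g] the
    representative [t u] is [1]. *)
Lemma schreier_extension_unique (K : groupType)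
    (phi1 phi2 : {multiplicative G -> K}) :
  (forall p, phi1 (schreier_basis p) = phi2 (schreier_basis p)) ->
  phi1 =1 phi2.
Proof.
move=> e12.
have e12g x u : phi1 (schreier_gen x u) = phi2 (schreier_gen x u).
  rewrite -schreier_gen_t; have [->|n1] := pselect (schreier_gen x (t u) = 1).
    by rewrite !multiplicative1.
  exact: (e12 (exist _ (x, t u) (conj (t_idem u) n1))).
suff e12u u g : psi g = (t u)^-1 * u -> phi1 g = phi2 g.
  by move=> g; apply: (e12u (psi g)); rewrite t_psi invg1 mul1g.
elim/(free_basis_ind bF): u g => [g|x u].
  rewrite t1 invg1 mul1g -(multiplicative1 psi) => /psi_inj ->.
  by rewrite !multiplicative1.
have egen := psi_schreier_gen x u.
split=> IHu g eg; last first.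
  have := IHu (schreier_gen x u * g).
  by rewrite !gmulfM e12g egen eg -!mulgA mulVKg => /(_ erefl)/mulgI.
have <- : schreier_gen x u * ((schreier_gen x u)^-1 * g) = g by exact: mulVKg.
rewrite [LHS]gmulfM [RHS]gmulfM e12g; congr (_ * _); apply: IHu.
by rewrite gmulfM multiplicativeV egen eg !invgM invgK -!mulgA !mulVKg mulKg.
Qed.

Lemma schreier_basis_free : free_basis schreier_basis.
Proof.
move=> K f; have [phi phif] := schreier_extension_exists f.
exists phi; split=> // psi' psi'f; apply: schreier_extension_unique => p.
by rewrite psi'f phif.
Qed.

End NielsenSchreier.

Theorem nielsen_schreier (F G : groupType) (psi : {multiplicative G -> F}) :
  free_group F -> injective psi -> free_group G.
Proof.
move=> [X [b bF]] psi_inj.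
have [|||t [t1 tH tM tI]] :=
  @schreier_transversal F X b bF (fun u => exists g, psi g = u).
- by exists 1; exact: multiplicative1.
- by move=> _ _ [g <-] [h <-]; exists (g * h); rewrite gmulfM.
- by move=> _ [g <-]; exists g^-1; rewrite multiplicativeV.
by exists _, (@schreier_basis F X b G psi t tH); exact: schreier_basis_free.
Qed.

(** * Word length in a hyperbolic group *)

Section WordLength.
Variables (G : groupType) (S : seq G) (genS : generates S).
Local Notation len := (word_length genS).

Lemma word_productP g n :
  reflect (exists w : seq G,
             [/\ size w = n, {subset w <= letters S} & \prod_(s <- w) s = g])
          (word_product S g n).
Proof.
apply: (iffP existsP) => [[w /eqP <-]|[w [sw wS <-]]].
  exists (map val w); rewrite size_map size_tuple big_map; split=> //.
  by move=> _ /mapP[s _ ->]; exact: valP.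
pose v := pmap (@insub G _ (seq_sub (letters S))) w.
have vw : map val v = w.
  rewrite /v pmap_filter; last exact: insubK.
  by apply/all_filterP/allP => s /wS sS; rewrite isSome_insub.
have sv : size v == n by rewrite -sw -vw size_map.
exists (Tuple sv); apply/eqP.
by rewrite -[in RHS]vw big_map.
Qed.

Lemma word_length_prod w :
  {subset w <= letters S} -> (len (\prod_(s <- w) s) <= size w)%N.
Proof.
move=> wS; rewrite /word_length; case: ex_minnP => m _; apply.
by apply/word_productP; exists w.
Qed.

Lemma word_length_word g : exists w : seq G,
  [/\ size w = len g, {subset w <= letters S} & \prod_(s <- w) s = g].
Proof. by rewrite /word_length; case: ex_minnP => m /word_productP. Qed.

Lemma word_lengthM g h : (len (g * h)%g <= len g + len h)%N.
Proof.
have [v [<- vS <-]] := word_length_word g.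
have [w [<- wS <-]] := word_length_word h.
rewrite -size_cat -big_cat; apply: word_length_prod => s.
by rewrite mem_cat => /orP[/vS|/wS].
Qed.

Lemma word_lengthV g : len g^-1 = len g.
Proof.
suff le h : (len h^-1 <= len h)%N.
  by apply/eqP; rewrite eqn_leq le -{1}[g]invgK le.
have [w [<- wS <-]] := word_length_word h.
rewrite -[w in leqLHS]revK -prodgV -(size_rev w).
rewrite -(size_map (fun s => s^-1)) -(big_map _ xpredT id).
apply: word_length_prod => _ /mapP[s + ->]; rewrite mem_rev => /wS.
rewrite !mem_cat => /orP[sS|/mapP[r rS ->]]; last by rewrite invgK rS.
by rewrite map_f ?orbT.
Qed.

(** Up to a constant factor, word length is the largest subadditive function on
    the group, because it is so on the letters.  Applied to the length of images
    in a free group, this bounds word length from below. *)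
Lemma subadditive_word_length (len' : G -> nat) :
    len' 1 = 0%N -> (forall g h, (len' (g * h)%g <= len' g + len' h)%N) ->
  exists K, forall g, (len' g <= K * len g)%N.
Proof.
move=> len1 lenM; exists (\max_(s <- letters S) len' s) => g.
have [w [<- wS <-]] := word_length_word g.
elim: w wS => [_|s w IHw sS]; first by rewrite big_nil len1.
rewrite big_cons (leq_trans (lenM _ _)) // mulnS leq_add //.
  by rewrite (@leq_bigmax_seq _ _ xpredT) // sS ?mem_head.
by apply: IHw => r rw; rewrite sS // inE rw orbT.
Qed.

End WordLength.

Section FourPoints.
Import Order.TTheory GRing.Theory Num.Theory.

(** The symmetric form of hyperbolicity: of the three sums of opposite distances
    between four points, the largest two are almost equal. *)
Lemma gromov_four_point (T : Type) (d : T -> T -> nat) :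
    (forall x y, d x y = d y x) -> gromov_hyperbolic d ->
  exists D, forall x y z w,
    (d x z + d y w <= maxn (d x y + d z w) (d y z + d x w) + D)%N.
Proof.
move=> dC [delta [delta0 hyp]].
pose D := Num.bound (2%:R * delta)%R.
have leD : (2%:R * delta < D%:R)%R by apply: archi_boundP; lra.
exists D => x y z w.
suff : (d x z + d y w <= d x y + d z w + D)%N \/
       (d x z + d y w <= d y z + d x w + D)%N by lia.
have := hyp w x y z; rewrite /gromov_product lerBlDr ge_min.
rewrite -!(ler_nat rat) !natrD.
by case/orP => le1; [left|right]; lra.
Qed.

End FourPoints.

(** Hyperbolicity enters the proof only through the last clause, which is the
    four-point condition at the corners [1, a, a * b, b] of a quadrilateral
    spanned by commuting elements. *)
Lemma hyperbolic_length (G : groupType) :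
    hyperbolic_group G ->
  exists (len : G -> nat) (D : nat),
    [/\ len 1 = 0%N,
        forall g h, (len (g * h)%g <= len g + len h)%N,
        forall len' : G -> nat, len' 1 = 0%N ->
          (forall g h, (len' (g * h)%g <= len' g + len' h)%N) ->
          exists K, forall g, (len' g <= K * len g)%N
      & forall a b, commute a b ->
          (len (a * b)%g + len (a / b)%g <= 2 * maxn (len a) (len b) + D)%N].
Proof.
move=> [S [genS hypG]].
have dC x y : word_dist genS x y = word_dist genS y x.
  by rewrite /word_dist -word_lengthV invgM invgK.
have [D fourG] := gromov_four_point dC hypG.
exists (word_length genS), D; split.
- apply/eqP; rewrite -leqn0.
  by have := @word_length_prod _ _ genS [::]; rewrite big_nil; apply.
- exact: word_lengthM.
- exact: subadditive_word_length.
- move=> a b ab; have := fourG 1 a (a * b) b.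
  rewrite /word_dist invg1 !mul1g !mulKg invgM.
  have -> : b^-1 * a^-1 * b = a^-1.
    by rewrite -mulgA -(commuteV (commute_sym ab) : _ * _ = _) mulKg.
  rewrite -(word_lengthV _ (a^-1 * b)) invgM invgK -(commuteV ab) word_lengthV.
  lia.
Qed.

(** The slopes [f n / n] are at least [1 / K].  So if the integer part of
    [E * f N / N] is minimal, then [f N / N] exceeds any other slope by at most
    [1 / E], that is by a factor of at most [(E + K) / E]. *)
Lemma almost_minimal_slope (f : nat -> nat) (E K : nat) :
    (forall n, n <= K * f n)%N ->
  exists2 N, (0 < N)%N & forall n, (E * n * f N <= (E + K) * N * f n)%N.
Proof.
move=> fK.
have ex : exists i, `[< exists2 N, (0 < N)%N & (E * f N %/ N)%N = i >].
  by exists (E * f 1 %/ 1)%N; apply/asboolP; exists 1%N.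
case: (ex_minnP ex) => i /asboolP[N N0 eN] imin; exists N => // n.
case: (posnP n) => [->|n0]; first by rewrite muln0.
have le1 : (i * n <= E * f n)%N.
  rewrite -leq_divRL //; apply: imin; apply/asboolP; by exists n.
have le2 : (E * f N <= i.+1 * N)%N.
  by rewrite -eN ltnW // -ltn_divLR.
have le3 := fK n.
have : (E * f N * n <= i.+1 * N * n)%N by rewrite leq_mul2r le2 orbT.
have : (i * n * N <= E * f n * N)%N by rewrite leq_mul2r le1 orbT.
have : (n * N <= K * f n * N)%N by rewrite leq_mul2r le3 orbT.
lia.
Qed.

(** Here [A], [B], [s], [t] are the lengths of [a ^+ 2], [b ^+ 2], [a * b] and
    [a / b].  The first hypothesis says that [A + B] is at least [4 * r], up to
    the factor [1 + 1 / (2 * C)].  This costs [4 * r / (2 * C + 1)], less than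
    the gain [2 * minn s t >= 4 * r / (2 * C)] in the upper bound, so [r] is
    bounded. *)
Lemma quadrilateral_bound (K C D r A B s t : nat) :
    (4 * (2 * C * K) * r <= (2 * C * K + K) * (A + B))%N ->
    (A + B <= 2 * maxn s t + D)%N -> (s + t <= 2 * r + D)%N ->
    (r <= C * s)%N -> (r <= C * t)%N ->
  (2 * K * r <= 3 * C * D * (2 * C * K + K))%N.
Proof.
move=> h1 h2 h3 hs ht.
pose m := minn s t; pose L := (2 * C * K + K)%N.
have hm : (r <= C * m)%N by rewrite /m /minn; case: ifP.
have h4 : (A + B + 2 * m <= 4 * r + 3 * D)%N by rewrite /m; lia.
have h5 : (L * (A + B + 2 * m) <= L * (4 * r + 3 * D))%N.
  by rewrite leq_mul2l h4 orbT.
have h6 : (C * (4 * (2 * C * K) * r) <= C * (L * (A + B)))%N.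
  by rewrite leq_mul2l h1 orbT.
have h7 : (C * (L * (A + B + 2 * m)) <= C * (L * (4 * r + 3 * D)))%N.
  by rewrite leq_mul2l h5 orbT.
have h8 : (2 * L * r <= 2 * L * (C * m))%N by rewrite leq_mul2l hm orbT.
move: h6 h7 h8; rewrite /L; lia.
Qed.

Lemma cancel_scale (E K N k P Q z : nat) :
    (0 < N)%N -> (E * (N * (k * Q) * 2) * P <= (E + K) * N * z)%N ->
  (2 * E * (k * P * Q) <= (E + K) * z)%N.
Proof.
move=> N0 le1; rewrite -(leq_pmul2l N0).
apply: leq_trans (_ : (E + K) * N * z <= _)%N.
  by apply: leq_trans le1; lia.
lia.
Qed.

(** [x] and [y] generate a copy of Z^2 which [p] and [q] project to two infinite
    cyclic groups. *)
Lemma no_independent_commuting_pair (G F F' : groupType)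
    (p : {multiplicative G -> F}) (q : {multiplicative G -> F'}) (x y : G) :
    hyperbolic_group G -> free_group F -> free_group F' ->
    commute x y -> p x != 1 -> p y = 1 -> q x = 1 -> q y != 1 ->
  False.
Proof.
move=> hypG freeF freeF' xy px py qx qy.
have [len [D [len1 lenM lip quad]]] := hyperbolic_length hypG.
have lenX g n : (len (g ^+ n) <= n * len g)%N.
  elim: n => [|n IHn]; first by rewrite len1.
  by rewrite expgS (leq_trans (lenM _ _)) // mulSn leq_add2l.
have growth (L : groupType) (f : {multiplicative G -> L}) z :
    free_group L -> f z != 1 ->
    exists K, forall g n, f g = f z ^+ n -> (n <= K * len g)%N.
  move=> /free_length[lenL [lenL1 lenLM lenLX]] fz.
  have [||K leK] := lip (lenL \o f).
  - by rewrite /= multiplicative1.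
  - by move=> g h /=; rewrite gmulfM.
  exists K => g n fg; apply: leq_trans (leK g).
  by rewrite /= fg lenLX.
have [Kx leKx] := growth _ p x freeF px.
have [Ky leKy] := growth _ q y freeF' qy.
(* [r <= C * len g] will hold for [g = a * b] and [g = a / b]; the slopes must
   be minimal up to a relative error, [K / E = 1 / (2 * C)], adapted to [C]. *)
pose K := maxn Kx Ky; pose C := (K * len x)%N; pose E := (2 * C * K)%N.
have leK1 n g : (n <= Kx * len g)%N -> (n <= K * len g)%N.
  by move/leq_trans; apply; rewrite leq_mul2r leq_maxl orbT.
have leK2 n g : (n <= Ky * len g)%N -> (n <= K * len g)%N.
  by move/leq_trans; apply; rewrite leq_mul2r leq_maxr orbT.
have xK n : (n <= K * len (x ^+ n))%N.
  by apply/leK1/leKx; rewrite multiplicativeX.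
have yK n : (n <= K * len (y ^+ n))%N.
  by apply/leK2/leKy; rewrite multiplicativeX.
have [N N0 slopex] := almost_minimal_slope E xK.
have [M M0 slopey] := almost_minimal_slope E yK.
set P := len (x ^+ N) in slopex; set Q := len (y ^+ M) in slopey.
have P0 : (0 < P)%N by have := xK N; rewrite -/P; case: (P) => //; lia.
have Q0 : (0 < Q)%N by have := yK M; rewrite -/Q; case: (Q) => //; lia.
have K0 : (0 < K)%N by have := xK N; case: (K) => //; lia.
have bounded k : (2 * K * (k * P * Q) <= 3 * C * D * (E + K))%N.
  (* The exponents [k * Q] and [k * P] balance the two bounds of the lengths of
     [a] and [b], so that both become [r]. *)
  set r := (k * P * Q)%N.
  pose a := x ^+ (N * (k * Q)); pose b := y ^+ (M * (k * P)).
  have ab : commute a b by exact: commuteX2.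
  have lea : (len a <= r)%N.
    by rewrite /a expgnA (leq_trans (lenX _ _)) // -/P /r; lia.
  have leb : (len b <= r)%N.
    by rewrite /b expgnA (leq_trans (lenX _ _)) // -/Q /r; lia.
  have pb : p b = 1 by rewrite multiplicativeX py expg1n.
  have diag g : p g = p a -> (r <= C * len g)%N.
    rewrite multiplicativeX => /leKx/leK1 leg.
    have leP : (P <= N * len x)%N by exact: lenX.
    have : (k * Q * P <= k * Q * (N * len x))%N by rewrite leq_mul2l leP orbT.
    have : (N * (k * Q) * len x <= K * len g * len x)%N.
      by rewrite leq_mul2r leg orbT.
    rewrite /C /r; lia.
  apply: (@quadrilateral_bound K C D r (len (a ^+ 2)) (len (b ^+ 2))
            (len (a * b)) (len (a / b))).
  - have := slopex (N * (k * Q) * 2)%N; have := slopey (M * (k * P) * 2)%N.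
    rewrite !(expgnA _ _ 2) -/a -/b -/E => le1 le2.
    have -> : (4 * (2 * C * K) * r = 2 * E * r + 2 * E * r)%N.
      by rewrite -mulnDl -mulnDl.
    rewrite mulnDr leq_add //; first exact: cancel_scale le2.
    by rewrite /r (mulnAC k); exact: cancel_scale le1.
  - have abab : commute (a * b) (a / b).
      have aba := commute_sym (commuteM (commute_refl a) ab).
      have abb := commute_sym (commuteM (commute_sym ab) (commute_refl b)).
      exact: commuteM aba (commuteV abb).
    have := quad _ _ abab.
    have -> : a * b * (a / b) = a ^+ 2.
      by rewrite -mulgA (mulgA b) -ab mulgK expg2.
    have -> // : a * b / (a / b) = b ^+ 2.
      by rewrite invgF ab -mulgA (mulgA a) ab mulgK expg2.
  - apply: leq_trans (quad _ _ ab) _.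
    by rewrite leq_add2r leq_pmul2l // geq_max lea leb.
  - by apply: diag; rewrite gmulfM pb mulg1.
  - by apply: diag; rewrite gmulfM multiplicativeV pb divg1.
set B := (3 * C * D * (E + K))%N in bounded.
have := bounded B.+1; rewrite leqNgt => /negP; apply.
apply: (@leq_trans (B.+1 * P * Q)).
  by rewrite -mulnA leq_pmulr ?muln_gt0 ?P0.
by rewrite leq_pmull // muln_gt0.
Qed.

(** * Embeddings in products of free groups *)

Lemma trivial_group_free (G : groupType) :
  (forall g : G, g = 1) -> free_group G.
Proof.
move=> G1; exists void, (@of_void G) => H f.
pose c (_ : G) : H := 1.
have cM : {morph c : g h / g * h} by move=> g h; rewrite /c mulg1.
pose phi : {multiplicative G -> H} :=
  HB.pack c (isMultiplicative.Build G H c cM).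
by exists phi; split=> [[]|psi _ g]; rewrite (G1 g) !multiplicative1.
Qed.

(** A smallest set of coordinates that separates the points of [G] cannot have
    two elements: their witnesses would be a commuting pair of the kind excluded
    by [no_independent_commuting_pair]. *)
Theorem free_of_embedding (G : groupType) (n : nat) (F : 'I_n -> groupType)
    (phi : {multiplicative G -> finite_group_prod F}) :
    hyperbolic_group G -> (forall i, free_group (F i)) -> injective phi ->
  free_group G.
Proof.
move=> hypG freeF phi_inj.
pose co i (g : G) : F i := phi g i.
have coM i : {morph co i : g h / g * h}.
  by move=> g h; rewrite /co gmulfM ffunE.
pose pr i : {multiplicative G -> F i} :=
  HB.pack (co i) (isMultiplicative.Build G (F i) (co i) (coM i)).
pose detects (I : {set 'I_n}) :=
  forall g, (forall i, i \in I -> pr i g = 1) -> g = 1.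
have ex : exists m, `[< exists2 I, detects I & #|I| = m >].
  exists #|[set: 'I_n]|; apply/asboolP; exists [set: 'I_n] => // g g1.
  apply: phi_inj; rewrite multiplicative1; apply/ffunP => i.
  by rewrite ffunE -(g1 i) ?inE.
case: (ex_minnP ex) => _ /asboolP[I detI <-] minI.
have witness i : i \in I -> exists x,
    pr i x != 1 /\ forall j, j \in I -> j != i -> pr j x = 1.
  move=> iI; apply: contrapT => none.
  have : (#|I| <= #|I :\ i|)%N.
    apply/minI/asboolP; exists (I :\ i) => // g g1; apply: detI => j jI.
    have g1' k : k \in I -> k != i -> pr k g = 1.
      by move=> kI ki; apply: g1; rewrite !inE ki.
    have [->|ji] := eqVneq j i; last exact: g1'.
    by apply: contrapT => /eqP gi; apply: none; exists g.
  by rewrite (cardsD1 i I) iI ltnn.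
have [I0|[i iI]] := set_0Vmem I.
  by apply: trivial_group_free => g; apply: detI => i; rewrite I0 inE.
apply: (@nielsen_schreier (F i) G (pr i)) => //.
suff Ii : I = [set i].
  move=> g h gh; apply/eqP; rewrite -divg_eq1; apply/eqP/detI => j.
  by rewrite Ii inE => /eqP ->; rewrite gmulfM multiplicativeV gh mulgV.
apply/eqP; rewrite finset.eqEsubset finset.sub1set iI andbT.
apply/fintype.subsetP => j jI; rewrite inE.
apply: contrapT => /negP ji.
have [x [xi x1]] := witness i iI; have [y [yj y1]] := witness j jI.
apply: (@no_independent_commuting_pair G _ _ (pr i) (pr j) x y) => //.
- apply/eqP; rewrite -divg_eq1; apply/eqP/detI => k kI.
  rewrite !gmulfM multiplicativeV gmulfM; have [ki|ki] := eqVneq k i.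
    by rewrite (y1 k) ?ki 1?eq_sym // mulg1 mul1g mulgV.
  by rewrite (x1 k) // mulg1 mul1g mulgV.
- by apply: y1 => //; rewrite eq_sym.
- exact: x1.
Qed.

Theorem corollary7 (Gamma : groupType)
    (Gamma_torsion_free : torsion_free Gamma)
    (Gamma_hyperbolic : hyperbolic_group Gamma)
    (Gamma_not_free : ~ free_group Gamma)
    (n : nat) (F : 'I_n -> groupType)
    (F_free : forall i : 'I_n, free_group (F i))
    (F_nonabelian : forall i : 'I_n, nonabelian (F i)) :
  ~ exists phi : {multiplicative Gamma -> finite_group_prod F}, injective phi.
Proof.
move=> [phi phi_inj]; apply: Gamma_not_free.
exact: free_of_embedding Gamma_hyperbolic F_free phi_inj.
Qed.
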